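(* Let $(X,M)$ be a locally compact uniform space. Then the following are equivalent for all $a\in U_X$ and $U\subseteq U_X$: (1) $a\lhd_XU$; (2) for every $b<_Xa$ there is $V\in\mathrm{Fin}(U_X)$ such that $b_*\subseteq V_*$ and $V<_XU$; (3) for every $b<_Xa$ there is $V\in\mathrm{Fin}(U_X)$ such that $b\sqsubseteq V$ and $V<_XU$; (4) for every $b<_Xa$ there is $V\in\mathrm{Fin}(U_X)$ such that $b\lhd_XV$ and $V<_XU$.
   Context: Foundations: constructive (Aczel's CZF with the Regular Extension Axiom; neither excluded middle nor choice is assumed). $\mathrm{Pow}(S)$ is the class of subsets of $S$; $\mathrm{Fin}(S)$ is the set of finitely enumerable subsets of $S$ (images of $\{0,\dots,n-1\}$). Formal topologies: a formal topology is $\mathcal S=(S,\lhd,\le)$ with $(S,\le)$ a preordered set and $\lhd$ a relation between $S$ and $\mathrm{Pow}(S)$ (a cover) such that $\{a\mid a\lhd U\}$ is a set for each $U\subseteq S$ and, for all $a,b\in S$, $U,V\subseteq S$: (1) $U\lhd U$; (2) $a\lhd U$ and $U\lhd V$ imply $a\lhd V$; (3) $a\lhd U$ and $a\lhd V$ imply $a\lhd U\downarrow V$; (4) $a\le b$ implies $a\lhd b$. Here $U\lhd V$ means $\forall a\in U\ (a\lhd V)$, $U\downarrow V=\{c\mid\exists a\in U\,\exists b\in V\ (c\le a,\ c\le b)\}$, and singletons are written as elements. The cover inductively generated on a preorder by given axioms $a\lhd C$ is the least cover (making the preorder a formal topology) that satisfies the axioms. Upper reals: $\mathbb R^u$ is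 the class of subsets $U\subseteq\mathbb Q^{>0}$ with $q\in U\iff\exists q'<q\,(q'\in U)$. $U\le V$ iff $V\subseteq U$; $U+V=\{q_1+q_2\mid q_1\in U,q_2\in V\}$; a non-negative rational $r$ is identified with $\{q\mid r<q\}$; $U<V$ iff $U+r\le V$ for some $r\in\mathbb Q^{>0}$ (so $U<q\iff q\in U$). Uniform spaces: a generalised metric on $X$ is $d\colon X\times X\to\mathbb R^u$ with $d(x,x)=0$ and $d(x,z)\le d(x,y)+d(y,z)$; generalised metrics are ordered pointwise. A generalised uniform space (gus) is $(X,M)$ with $M$ a set of generalised metrics on $X$ that is inhabited and closed under binary sups. A uniform space here is a gus $(X,M)$ such that each $d\in M$ is symmetric, with values that are (upper cuts of) non-negative finite Dedekind reals (i.e. each $d$ is a pseudometric), and which is separated: $[\forall d\in M\ d(x,y)=0]\iff x=y$. Open balls: $\mathrm B_d(x,\varepsilon)=\{x'\mid d(x,x')<\varepsilon\}$ for $d\in M$, $\varepsilon\in\mathbb Q^{>0}$. Subsets carry the restricted pseudometrics. A Cauchy filter on $X$ is a set $\mathcal F$ of inhabited subsets, closed under supersets and binary intersections, such that for all $d,\varepsilon$ some $\mathrm B_d(x,\varepsilon)\in\mathcal F$; it converges to $x$ if all $\mathrm B_d(x,\varepsilon)\in\mathcal F$; $X$ is complete if every Cauchy filter converges to some point. $X$ is totally bounded if for all $d\in M$, $\varepsilon\in\mathbb Q^{>0}$ there is $Y\in\mathrm{Fin}(X)$ with $X\subseteq\bigcup_{y\in Y}\mathrm B_d(y,\varepsilon)$;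 compact if complete and totally bounded; locally compact if every open ball is contained in a compact subset. Localic completion: for a gus $(X,M)$ let $U_X=M\times\mathbb Q^{>0}\times X$, with elements written $\mathsf b_d(x,\varepsilon)$. Put $\mathsf b_d(y,\delta)\le_X\mathsf b_\rho(x,\varepsilon)$ iff $\rho\le d$ and $\rho(x,y)+\delta\le\varepsilon$; and $\mathsf b_d(y,\delta)<_X\mathsf b_\rho(x,\varepsilon)$ iff $\rho\le d$ and $\rho(x,y)+\delta<\varepsilon$. For subsets, $U\le_XV$ iff $\forall a\in U\,\exists b\in V\ (a\le_Xb)$, and similarly $U<_XV$. $\mathcal U(X)=(U_X,\lhd_X,\le_X)$ where $\lhd_X$ is inductively generated by the axioms, for all $a\in U_X$: (U1) $a\lhd_X\{b\mid b<_Xa\}$; (U2) $a\lhd_X\mathcal C_d^\varepsilon$ for each $d\in M$, $\varepsilon\in\mathbb Q^{>0}$, where $\mathcal C_d^\varepsilon=\{\mathsf b_d(x,\varepsilon)\mid x\in X\}$. Notation: $\mathsf b_d(x,\varepsilon)_*=\mathrm B_d(x,\varepsilon)$, and $V_*=\bigcup_{c\in V}c_*$ for $V\subseteq U_X$. For $U,V\subseteq U_X$, $U\sqsubseteq V$ means that there are $d\in M$, $\varepsilon\in\mathbb Q^{>0}$ with $U\downarrow\mathcal C_d^\varepsilon\le_XV$ ($\downarrow$ with respect to $\le_X$); $b\sqsubseteq V$ means $\{b\}\sqsubseteq V$. *)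

(* Defs.v *)
From mathcomp Require Import all_boot all_order all_algebra.
From mathcomp Require Import interval_inference lra.
From mathcomp Require Import classical_sets.

Set Implicit Arguments.
Unset Strict Implicit.
Unset Printing Implicit Defensive.

Import Order.TTheory GRing.Theory Num.Theory.
Local Open Scope classical_set_scope.
Local Open Scope ring_scope.

(* Only the (axiom-free) set notations of classical_sets are used: sets are
   [Prop]-valued predicates and no decidability is assumed anywhere. *)

(* Fin(T): images of {0,...,n-1}. The library's [finite_set] asks for a
   bijection, which is constructively stronger. *)
Definition finitely_enumerable (T : Type) (V : set T) : Prop :=
  exists (n : nat) (f : 'I_n -> T), forall x, V x <-> exists i, f i = x.

Definition down_meet (S : Type) (le : S -> S -> Prop) (U V : set S) : set S :=
  [set c | exists a b, [/\ U a, V b, le c a & le c b]].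

Definition is_preorder (S : Type) (le : S -> S -> Prop) : Prop :=
  (forall a, le a a) /\ (forall a b c, le a b -> le b c -> le a c).

Record is_cover (S : Type) (le : S -> S -> Prop) (cov : S -> set S -> Prop) :
    Prop := IsCover {
  cover_refl : forall U a, U a -> cov a U;
  cover_trans : forall a U V, cov a U -> (forall b, U b -> cov b V) -> cov a V;
  cover_down : forall a U V, cov a U -> cov a V -> cov a (down_meet le U V);
  cover_le : forall a b, le a b -> cov a [set b] }.

Record formalTopology := FormalTopology {
  ft_base :> Type;
  ft_le : ft_base -> ft_base -> Prop;
  ft_cov : ft_base -> set ft_base -> Prop;
  ft_preorder : is_preorder ft_le;
  ft_cover : is_cover ft_le ft_cov }.

(* The least cover satisfying the axioms [ax]: the intersection of all of them
   is again one, see [generated_is_cover] and [generated_ax]. *)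
Definition generated_cover (S : Type) (le : S -> S -> Prop)
    (ax : S -> set S -> Prop) : S -> set S -> Prop :=
  fun a U => forall cov : S -> set S -> Prop,
    is_cover le cov -> (forall b C, ax b C -> cov b C) -> cov a U.

Lemma generated_is_cover (S : Type) (le : S -> S -> Prop)
    (ax : S -> set S -> Prop) : is_cover le (generated_cover le ax).
Proof.
split=> [U a Ua|a U V aU UV|a U V aU aV|a b ab] cov covP covax.
- exact: (cover_refl covP Ua).
- by apply: (cover_trans covP (aU _ covP covax)) => b Ub; apply: UV.
- exact: (cover_down covP (aU _ covP covax) (aV _ covP covax)).
- exact: (cover_le covP ab).
Qed.

Lemma generated_ax (S : Type) (le : S -> S -> Prop) (ax : S -> set S -> Prop) a C :
  ax a C -> generated_cover le ax a C.
Proof. by move=> aC cov _; apply. Qed.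

Record ureal := UReal {
  ucut :> set rat;
  ucut_gt0 : forall q, ucut q -> 0 < q;
  ucut_rounded : forall q, ucut q <-> exists q', q' < q /\ ucut q' }.

Definition uleq (U V : ureal) : Prop := V `<=` U.

(* Upper reals are compared extensionally, not with Leibniz equality. *)
Definition ueq (U V : ureal) : Prop := uleq U V /\ uleq V U.

Definition uadd_cut (U V : set rat) : set rat :=
  [set q | exists q1 q2, [/\ U q1, V q2 & q = q1 + q2]].

Lemma uadd_gt0 (U V : ureal) q : uadd_cut U V q -> 0 < q.
Proof.
by move=> [q1 [q2 [/ucut_gt0 q1_gt0 /ucut_gt0 q2_gt0 ->]]]; apply: addr_gt0.
Qed.

Lemma uadd_rounded (U V : ureal) q :
  uadd_cut U V q <-> exists q', q' < q /\ uadd_cut U V q'.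
Proof.
split=> [[q1 [q2 [/ucut_rounded [q1' [lt_q1 Uq1]] Vq2 ->]]]|].
  by exists (q1' + q2); split; [lra | exists q1', q2].
move=> [q' [lt_q' [q1 [q2 [Uq1 Vq2 eq_q']]]]]; exists (q - q2), q2.
by split=> //; [apply/ucut_rounded; exists q1; split=> //; lra | lra].
Qed.

Definition uadd (U V : ureal) : ureal :=
  UReal (@uadd_gt0 U V) (@uadd_rounded U V).

(* The upper real {q in Q^{>0} | r < q}; a negative [r] also gives 0. *)
Definition urat_cut (r : rat) : set rat := [set q | 0 < q /\ r < q].

Lemma urat_gt0 r q : urat_cut r q -> 0 < q.
Proof. by case. Qed.

Lemma urat_rounded r q : urat_cut r q <-> exists q', q' < q /\ urat_cut r q'.
Proof.
split=> [[q_gt0 lt_rq]|[q' [lt_q' [q'_gt0 lt_rq']]]]; last by split; lra.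
have [r_ge0|r_lt0] := lerP 0 r.
  by exists ((r + q) / 2%:R); split; [lra | split; lra].
by exists (q / 2%:R); split; [lra | split; lra].
Qed.

Definition urat (r : rat) : ureal := UReal (@urat_gt0 r) (@urat_rounded r).

Definition ult (U V : ureal) : Prop :=
  exists2 r : rat, 0 < r & uleq (uadd U (urat r)) V.

(* Finite Dedekind reals: two-sided located cuts of Q with both sides
   inhabited. *)
Record is_dedekind_cut (L D : set rat) : Prop := IsDedekindCut {
  dcut_lower : L !=set0;
  dcut_upper : D !=set0;
  dcut_lower_rounded : forall p, L p <-> exists p', p < p' /\ L p';
  dcut_upper_rounded : forall q, D q <-> exists q', q' < q /\ D q';
  dcut_disjoint : forall q, ~ (L q /\ D q);
  dcut_located : forall p q, p < q -> L p \/ D q }.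

(* Non-negativity of the Dedekind real is automatic, as an upper real only
   contains positive rationals. *)
Definition is_dedekind (U : ureal) : Prop := exists L, is_dedekind_cut L U.

Record gmetric (X : Type) := GMetric {
  gdist :> X -> X -> ureal;
  gdist_refl : forall x, ueq (gdist x x) (urat 0);
  gdist_triangle : forall x y z,
    uleq (gdist x z) (uadd (gdist x y) (gdist y z)) }.

Definition gmetric_le (X : Type) (d e : gmetric X) : Prop :=
  forall x y, uleq (d x y) (e x y).

Definition is_gmetric_sup (X : Type) (d e s : gmetric X) : Prop :=
  [/\ gmetric_le d s, gmetric_le e s &
      forall t, gmetric_le d t -> gmetric_le e t -> gmetric_le s t].

Record gus := Gus {
  gus_point :> Type;
  gus_metrics : set (gmetric gus_point);
  gus_inhabited : gus_metrics !=set0;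
  gus_sup : forall d e, gus_metrics d -> gus_metrics e ->
    exists2 s, gus_metrics s & is_gmetric_sup d e s }.

Record is_uniform_space (X : gus) : Prop := IsUniformSpace {
  us_sym : forall d, gus_metrics d -> forall x y : X, ueq (d x y) (d y x);
  us_dedekind : forall d, gus_metrics d -> forall x y : X, is_dedekind (d x y);
  us_separated : forall x y : X,
    (forall d, gus_metrics d -> ueq (d x y) (urat 0)) <-> x = y }.

Definition open_ball (X : Type) (d : gmetric X) (x : X) (eps : {posnum rat}) :
    set X :=
  [set x' | ult (d x x') (urat eps%:num)].

(* The next notions are stated for a subset [K] carrying the restricted
   metrics; open balls of [K] are the traces on [K] of the balls centred
   in [K]. *)
Record is_cauchy_filter (X : gus) (K : set X) (F : set (set X)) : Prop :=
    IsCauchyFilter {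
  cf_inhabited : forall A, F A -> A `<=` K /\ A !=set0;
  cf_superset : forall A B, F A -> A `<=` B -> B `<=` K -> F B;
  cf_setI : forall A B, F A -> F B -> F (A `&` B);
  cf_cauchy : forall d eps, gus_metrics d ->
    exists2 x, K x & F (K `&` open_ball d x eps) }.

Definition filter_converges (X : gus) (K : set X) (F : set (set X)) (x : X) :
    Prop :=
  forall d eps, gus_metrics d -> F (K `&` open_ball d x eps).

Definition complete_subset (X : gus) (K : set X) : Prop :=
  forall F, is_cauchy_filter K F -> exists2 x, K x & filter_converges K F x.

Definition totally_bounded_subset (X : gus) (K : set X) : Prop :=
  forall d eps, gus_metrics d ->
    exists Y : set X, [/\ finitely_enumerable Y, Y `<=` K &
      K `<=` [set x | exists2 y, Y y & open_ball d y eps x]].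

Definition compact_subset (X : gus) (K : set X) : Prop :=
  complete_subset K /\ totally_bounded_subset K.

Definition locally_compact (X : gus) : Prop :=
  forall d (x : X) eps, gus_metrics d ->
    exists2 K, compact_subset K & open_ball d x eps `<=` K.

(* [FBall d eps x] is the formal ball b_d(x,eps), an element of U_X. *)
Record fball (X : gus) := FBall {
  fb_metric : {d : gmetric X | gus_metrics d};
  fb_radius : {posnum rat};
  fb_center : X }.

Definition fb_dist (X : gus) (a : fball X) : gmetric X := sval (fb_metric a).

Definition fball_le (X : gus) (b a : fball X) : Prop :=
  gmetric_le (fb_dist a) (fb_dist b) /\
  uleq (uadd (fb_dist a (fb_center a) (fb_center b)) (urat (fb_radius b)%:num))
       (urat (fb_radius a)%:num).

Definition fball_lt (X : gus) (b a : fball X) : Prop :=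
  gmetric_le (fb_dist a) (fb_dist b) /\
  ult (uadd (fb_dist a (fb_center a) (fb_center b)) (urat (fb_radius b)%:num))
      (urat (fb_radius a)%:num).

Definition fballs_le (X : gus) (U V : set (fball X)) : Prop :=
  forall a, U a -> exists2 b, V b & fball_le a b.

Definition fballs_lt (X : gus) (U V : set (fball X)) : Prop :=
  forall a, U a -> exists2 b, V b & fball_lt a b.

(* C_d^eps *)
Definition fballs_of (X : gus) (d : {d : gmetric X | gus_metrics d})
    (eps : {posnum rat}) : set (fball X) :=
  range (fun x => FBall d eps x).

Inductive completion_axiom (X : gus) : fball X -> set (fball X) -> Prop :=
| Completion_U1 a : completion_axiom a [set b | fball_lt b a]
| Completion_U2 a d eps : completion_axiom a (fballs_of d eps).

Lemma fball_le_preorder (X : gus) : is_preorder (@fball_le X).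
Proof.
split=> [a|c b a [le_cb cb] [le_ba ba]].
  split=> [x y q //|q [q_gt0 lt_aq]].
  have a_gt0 : 0 < (fb_radius a)%:num by [].
  have a_lt : (fb_radius a)%:num < q by [].
  exists ((q - (fb_radius a)%:num) / 2%:R), ((q + (fb_radius a)%:num) / 2%:R).
  split; last lra; last by split; lra.
  by case: (gdist_refl (fb_dist a) (fb_center a)) => + _; apply; split; lra.
split=> [x y q /le_cb/le_ba //|q /ba [q1 [q2 [ab_q1 lt_q2 ->]]]].
have [q3 [q4 [/le_ba bc_q3 lt_q4 ->]]] := cb _ lt_q2.
exists (q1 + q3), q4; split=> //; last by rewrite addrA.
by apply: (@gdist_triangle _ (fb_dist a) _ (fb_center b)); exists q1, q3.
Qed.

Definition localic_completion (X : gus) : formalTopology :=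
  FormalTopology (@fball_le_preorder X)
    (@generated_is_cover _ (@fball_le X) (@completion_axiom X)).

Definition completion_cov (X : gus) (a : fball X) (U : set (fball X)) : Prop :=
  @ft_cov (localic_completion X) a U.

(* a_* and V_* *)
Definition fball_ext (X : gus) (a : fball X) : set X :=
  open_ball (fb_dist a) (fb_center a) (fb_radius a).

Definition fballs_ext (X : gus) (V : set (fball X)) : set X :=
  \bigcup_(c in V) fball_ext c.

(* U ⊑ V *)
Definition fballs_sqsub (X : gus) (U V : set (fball X)) : Prop :=
  exists d eps, fballs_le (down_meet (@fball_le X) U (fballs_of d eps)) V.

(* Main.v *)
Require Import Defs.
From mathcomp Require Import all_boot all_order all_algebra.
From mathcomp Require Import interval_inference lra.
From mathcomp Require Import classical_sets.

(** (1) => (2): the relation defined by (2) is a cover satisfying (U1) and (U2),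
    hence contains the generated one. Stability under [down_meet] and (U2) are
    the only points that use local compactness, and only through total
    boundedness: a ball [b_*] is covered by finitely many small balls, and
    locatedness of the distances allows one to discard those centred too far
    from [b] without using excluded middle. (2) => (3): enlarge the members of
    [V] by a common radius [eps]; then every ball of radius at most [eps]
    centred in [V_*] is below one of the enlarged balls. (3) => (4) => (1) holds
    in any localic completion. *)

Set Implicit Arguments.
Unset Strict Implicit.

Import Order.TTheory GRing.Theory Num.Theory.
Local Open Scope classical_set_scope.
Local Open Scope ring_scope.

(** * Finitely enumerable sets *)

Lemma finitely_enumerable0 (T : Type) : finitely_enumerable (@set0 T).
Proof.
have f : 'I_0 -> T by case.
by exists 0%N, f => x; split=> // -[[]].
Qed.

Lemma finitely_enumerable1 (T : Type) (x : T) : finitely_enumerable [set x].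
Proof. by exists 1%N, (fun=> x) => y; split=> [->|[]//]; exists ord0. Qed.

Lemma finitely_enumerableU (T : Type) (V W : set T) :
  finitely_enumerable V -> finitely_enumerable W ->
  finitely_enumerable (V `|` W).
Proof.
move=> [n [f fP]] [m [g gP]].
exists (n + m)%N,
  (fun i => match split i with inl j => f j | inr k => g k end) => x.
split=> [[/fP [i <-]|/gP [i <-]]|[i <-]].
- by exists (unsplit (inl i)); rewrite unsplitK.
- by exists (unsplit (inr i)); rewrite unsplitK.
by case: (split i) => j; [left; apply/fP; exists j | right; apply/gP; exists j].
Qed.

Lemma finitely_enumerable_image (T T' : Type) (h : T -> T') (V : set T) :
  finitely_enumerable V -> finitely_enumerable (h @` V).
Proof.
move=> [n [f fP]]; exists n, (h \o f) => y; split=> [[x /fP [i <-] <-]|[i <-]].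
  by exists i.
by exists (f i) => //; apply/fP; exists i.
Qed.

(* Finite choice with the witnesses merged into a single one: this is the only
   form of choice needed. *)
Lemma finitely_enumerable_directed (T I : Type) (V : set T) (D : set I)
    (P : T -> I -> Prop) :
  finitely_enumerable V -> D !=set0 ->
  (forall i j, D i -> D j ->
    exists2 k, D k & forall x, P x i \/ P x j -> P x k) ->
  (forall x, V x -> exists2 i, D i & P x i) ->
  exists2 i, D i & forall x, V x -> P x i.
Proof.
move=> [n [f fP]] [i0 Di0] Ddir VP.
suff [i Di Pi] : exists2 i, D i & forall k, P (f k) i.
  by exists i => // x /fP [k <-].
have {VP} : forall k, exists2 i, D i & P (f k) i.
  by move=> k; apply: VP; apply/fP; exists k.
elim: n f {fP} => [|n IHn] f fP; first by exists i0 => // -[].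
have [i Di Pi] := IHn (fun k => f (lift ord0 k)) (fun k => fP _).
have [j Dj Pj] := fP ord0.
have [k Dk Pk] := Ddir i j Di Dj.
exists k => // l; apply: Pk.
by case: (unliftP ord0 l) => [m ->|->]; [left | right].
Qed.

(** * Upper cuts and generalised metrics *)

Lemma posnum_lower_bound (x y : {posnum rat}) :
  exists e : {posnum rat}, e%:num <= x%:num /\ e%:num <= y%:num.
Proof.
have [xy|yx] := lerP x%:num y%:num; first by exists x.
by exists y; split=> //; apply: ltW.
Qed.

Lemma ucut_le (U : ureal) p q : ucut U p -> p <= q -> ucut U q.
Proof.
rewrite le_eqVlt => Up /predU1P [<- //|lt_pq].
by apply/ucut_rounded; exists p.
Qed.

Lemma ultP (U : ureal) (e : {posnum rat}) : ult U (urat e%:num) <-> ucut U e%:num.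
Proof.
have e_gt0 : 0 < e%:num by [].
split=> [[r r_gt0 Ule]|/ucut_rounded [q [lt_qe Uq]]].
  have [|q1 [q2 [Uq1 [_ lt_q2] eqq]]] := Ule (e%:num + r).
    by split; lra.
  by apply: ucut_le Uq1 _; lra.
exists (e%:num - q); first lra.
move=> t [t_gt0 lt_et]; exists q, (t - q); split=> //; last lra.
by split; lra.
Qed.

Lemma open_ballP {X : Type} (d : gmetric X) (x y : X) (e : {posnum rat}) :
  open_ball d x e y <-> ucut (d x y) e%:num.
Proof. exact: ultP. Qed.

Section GMetric.
Context {X : Type}.
Implicit Types (d : gmetric X) (x y z : X).

Lemma ucut_dist_refl d x q : 0 < q -> ucut (d x x) q.
Proof. by move=> q_gt0; case: (gdist_refl d x) => + _; apply; split. Qed.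

Lemma ucut_dist_triangle d x y z p q :
  ucut (d x y) p -> ucut (d y z) q -> ucut (d x z) (p + q).
Proof. by move=> xy yz; apply: (@gdist_triangle _ d x y z); exists p, q. Qed.

Lemma gmetric_le_refl d : gmetric_le d d.
Proof. by move=> x y q. Qed.

Lemma gmetric_le_trans d e f :
  gmetric_le d e -> gmetric_le e f -> gmetric_le d f.
Proof. by move=> de ef x y q /ef/de. Qed.

End GMetric.

(** * Formal balls: the two orders, and enlargement *)

Section FormalBalls.
Context {X : gus}.
Implicit Types (a b c : fball X) (U V W : set (fball X)).

Notation metric := {d : gmetric X | gus_metrics d}.
Notation center := (@fb_center X).
Notation radius a := (fb_radius a)%:num.

Lemma metric_ub (d e : metric) :
  exists s : metric, gmetric_le (sval d) (sval s) /\ gmetric_le (sval e) (sval s).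
Proof.
case: d e => [d Md] [e Me]; have [s Ms [ds es _]] := gus_sup Md Me.
by exists (exist _ s Ms).
Qed.

(* The subtraction-free form of [d + r_b <= r_a] is that [r_b] can be subtracted
   from every rational above [r_a]. *)
Lemma fball_leP b a : fball_le b a <->
  gmetric_le (fb_dist a) (fb_dist b) /\
  (forall q, radius a < q -> ucut (fb_dist a (center a) (center b)) (q - radius b)).
Proof.
have a_gt0 : 0 < radius a by [].
have b_gt0 : 0 < radius b by [].
split=> -[dab le_ba]; split=> // q.
  move=> lt_aq.
  have [|q1 [q2 [abq1 [_ lt_q2] eqq]]] := le_ba q.
    by split; lra.
  by apply: ucut_le abq1 _; lra.
move=> [q_gt0 /le_ba /ucut_rounded [t [lt_t abt]]].
by exists t, (q - t); split=> //; [split; lra | lra].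
Qed.

Lemma fball_ltP b a : fball_lt b a <->
  gmetric_le (fb_dist a) (fb_dist b) /\
  ucut (fb_dist a (center a) (center b)) (radius a - radius b).
Proof.
have b_gt0 : 0 < radius b by [].
rewrite /fball_lt; split=> -[dab]; rewrite ultP.
  move=> [q1 [q2 [abq1 [_ lt_q2] ->]]]; split=> //.
  by apply: ucut_le abq1 _; lra.
move=> /ucut_rounded [t [lt_t abt]]; split=> //.
by exists t, (radius a - t); split=> //; [split; lra | lra].
Qed.

Lemma fball_extP a x :
  fball_ext a x <-> ucut (fb_dist a (center a) x) (radius a).
Proof. exact: open_ballP. Qed.

Lemma fball_ltW b a : fball_lt b a -> fball_le b a.
Proof.
move=> /fball_ltP [dab lt_ba]; apply/fball_leP; split=> // q lt_aq.
by apply: ucut_le lt_ba _; lra.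
Qed.

Lemma fball_lt_le_trans c b a : fball_lt c b -> fball_le b a -> fball_lt c a.
Proof.
move=> /fball_ltP [dbc /ucut_rounded [t [lt_t bct]]] /fball_leP [dab ba].
apply/fball_ltP; split; first exact: gmetric_le_trans dab dbc.
(* [fball_leP] speaks only of rationals strictly above [radius a]; the excess is paid by the slack
   that roundedness leaves in [c < b]. *)
have /ba abq : radius a < radius a + (radius b - radius c - t) by lra.
by apply: ucut_le (ucut_dist_triangle abq (dab _ _ _ bct)) _; lra.
Qed.

Lemma fball_le_lt_trans c b a : fball_le c b -> fball_lt b a -> fball_lt c a.
Proof.
move=> /fball_leP [dbc bc] /fball_ltP [dab /ucut_rounded [t [lt_t abt]]].
apply/fball_ltP; split; first exact: gmetric_le_trans dab dbc.
have /bc bcq : radius b < radius b + (radius a - radius b - t) by lra.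
by apply: ucut_le (ucut_dist_triangle abt (dab _ _ _ bcq)) _; lra.
Qed.

Definition fball_enlarge a (e : {posnum rat}) : fball X :=
  FBall (fb_metric a) ((radius a + e%:num)%:pos)%R (center a).

Lemma fball_lt_enlarge a e : fball_lt a (fball_enlarge a e).
Proof.
have e_gt0 : 0 < e%:num by [].
apply/fball_ltP; split; first exact: gmetric_le_refl.
by apply: ucut_dist_refl => /=; lra.
Qed.

Lemma fball_enlarge_le a (e f : {posnum rat}) :
  e%:num <= f%:num -> fball_le (fball_enlarge a e) (fball_enlarge a f).
Proof.
move=> le_ef; apply/fball_leP; split; first exact: gmetric_le_refl.
by move=> q /= lt_q; apply: ucut_dist_refl; lra.
Qed.

(** Distances have rounded cuts, so a strict inequality between formal balls leaves a positive
    rational to spare. This makes the strict order interpolative. *)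
Lemma fball_lt_enlargeP b a :
  fball_lt b a -> exists e, fball_lt (fball_enlarge b e) a.
Proof.
move=> /fball_ltP [dab /ucut_rounded [t [lt_t abt]]].
have e_gt0 : 0 < radius a - radius b - t by lra.
exists (PosNum e_gt0); apply/fball_ltP; split=> //=.
by apply: ucut_le abt _; lra.
Qed.

Lemma fball_le_ext b a : fball_le b a -> fball_ext b `<=` fball_ext a.
Proof.
move=> /fball_leP [dab ba] x /fball_extP /ucut_rounded [t [lt_t bxt]].
apply/fball_extP.
have /ba abq : radius a < radius a + (radius b - t) by lra.
by apply: ucut_le (ucut_dist_triangle abq (dab _ _ _ bxt)) _; lra.
Qed.

(** An admissible enlargement may always be decreased, so the finitely many ones can be replaced by
    a common lower bound. *)
Lemma fballs_lt_enlarge V U :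
  finitely_enumerable V -> fballs_lt V U ->
  exists e, forall v, V v -> exists2 u, U u & fball_lt (fball_enlarge v e) u.
Proof.
move=> feV VU.
pose P v e := exists2 u, U u & fball_lt (fball_enlarge v e) u.
have [] := @finitely_enumerable_directed _ _ V setT P feV.
- by exists 1%:pos.
- move=> e f _ _; have [g [ge gf]] := posnum_lower_bound e f.
  by exists g => // v [] [u Uu vu]; exists u => //;
    apply: fball_le_lt_trans vu; apply: fball_enlarge_le.
- by move=> v /VU [u Uu /fball_lt_enlargeP [e veu]]; exists e => //; exists u.
by move=> e _ eP; exists e.
Qed.

Lemma fballs_metric_ub V : finitely_enumerable V ->
  exists d : metric, forall v, V v -> gmetric_le (fb_dist v) (sval d).
Proof.
move=> feV; have [m0 Mm0] := gus_inhabited X.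
pose P v (d : metric) := gmetric_le (fb_dist v) (sval d).
have [] := @finitely_enumerable_directed _ _ V setT P feV.
- by exists (exist _ m0 Mm0).
- move=> d e _ _; have [s [ds es]] := metric_ub d e.
  by exists s => // v [vd|ve]; [apply: gmetric_le_trans vd ds
                              | apply: gmetric_le_trans ve es].
- by move=> v Vv; exists (fb_metric v) => //; apply: gmetric_le_refl.
by move=> d _ dP; exists d.
Qed.

Lemma fballs_sqsub_ext b b' V U :
  fball_lt b b' -> finitely_enumerable V -> fball_ext b' `<=` fballs_ext V ->
  fballs_lt V U ->
  exists V', [/\ finitely_enumerable V', fballs_sqsub [set b] V' & fballs_lt V' U].
Proof.
move=> lt_bb' feV b'V VU.
have [e eP] := fballs_lt_enlarge feV VU.
have [d dP] := fballs_metric_ub feV.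
exists ((fun v => fball_enlarge v e) @` V); split.
- exact: finitely_enumerable_image.
- exists d, e => c [_ [_ [-> [y _ <-] cb cy]]].
  have c_gt0 : 0 < radius c by [].
  have /b'V [v Vv /fball_extP vc] : fball_ext b' (center c).
    have /fball_ltP [db'c b'c] := fball_le_lt_trans cb lt_bb'.
    by apply/fball_extP; apply: ucut_le b'c _; lra.
  exists (fball_enlarge v e); first by exists v.
  have /fball_leP [dc yc] := cy.
  apply/fball_leP; split; first exact: gmetric_le_trans (dP _ Vv) dc.
  (* If [c] had radius above [e], subtracting it would put 0 into the cut of a distance, but cuts
     contain only positive rationals. *)
  have le_ce : radius c <= e%:num.
    rewrite leNgt; apply/negP => lt_ec.
    by have /ucut_gt0 := yc _ lt_ec; rewrite subrr ltxx.
  by move=> q /= lt_q; apply: ucut_le vc _; lra.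
by move=> _ [v Vv <-]; apply: eP.
Qed.

(** * Covers in an arbitrary localic completion *)

Lemma completion_cov_is_cover : is_cover (@fball_le X) (@completion_cov X).
Proof. exact: generated_is_cover. Qed.

(** By (U2), [b] is covered by the balls of [fballs_of d e], hence by their meet with [b], and this
    meet refines [V]. *)
Lemma completion_cov_sqsub b V : fballs_sqsub [set b] V -> completion_cov b V.
Proof.
move=> [d [e bV]]; have covP := completion_cov_is_cover.
have bd : completion_cov b (fballs_of d e) by apply: generated_ax; apply: Completion_U2.
have bb : completion_cov b [set b] by apply: (cover_refl covP).
apply: (cover_trans covP (cover_down covP bb bd)) => c.
move=> /bV [v Vv cv]; apply: (cover_trans covP (cover_le covP cv)).
by move=> _ ->; apply: (cover_refl covP).
Qed.

Lemma completion_cov_lt a U :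
  (forall b, fball_lt b a -> exists V, completion_cov b V /\ fballs_lt V U) ->
  completion_cov a U.
Proof.
move=> aU; have covP := completion_cov_is_cover.
apply: (@cover_trans _ _ _ covP a [set b | fball_lt b a]).
  by apply: generated_ax; apply: Completion_U1.
move=> b /aU [V [bV VU]]; apply: (cover_trans covP bV) => v /VU [u Uu /fball_ltW vu].
apply: (cover_trans covP (cover_le covP vu)) => _ ->.
exact: (cover_refl covP).
Qed.

(** * Condition (2) as a relation, and its transitivity *)

Definition finite_ext_cov a U : Prop :=
  forall b, fball_lt b a -> exists V,
    [/\ finitely_enumerable V, fball_ext b `<=` fballs_ext V & fballs_lt V U].

Lemma finite_ext_cov_lt a b c U :
  fball_lt b a -> fball_le a c -> U c -> exists V,
    [/\ finitely_enumerable V, fball_ext b `<=` fballs_ext V & fballs_lt V U].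
Proof.
move=> ba ac Uc; exists [set b]; split; first exact: finitely_enumerable1.
  by move=> x bx; exists b.
by move=> _ ->; exists c => //; apply: fball_lt_le_trans ba ac.
Qed.

(** Admissible families are closed under union, and a larger [V] still covers [A y]; so one family
    serves all of [Y]. *)
Lemma finite_ext_cov_collect (T : Type) (Y : set T) (A : T -> set X) U :
  finitely_enumerable Y ->
  (forall y, Y y -> exists V,
    [/\ finitely_enumerable V, A y `<=` fballs_ext V & fballs_lt V U]) ->
  exists V, [/\ finitely_enumerable V,
    \bigcup_(y in Y) A y `<=` fballs_ext V & fballs_lt V U].
Proof.
move=> feY YV.
pose D V := finitely_enumerable V /\ fballs_lt V U.
pose P y V := A y `<=` fballs_ext V.
have [||y /YV [V [feV AV VU]]|V [feV VU] AV] :=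
  @finitely_enumerable_directed _ _ Y D P feY.
- by exists set0; split; [apply: finitely_enumerable0 | move=> ? []].
- move=> V W [feV VU] [feW WU]; exists (V `|` W).
    by split=> [|v [/VU|/WU] //]; apply: finitely_enumerableU.
  by move=> y [AV|AW] x; [move=> /AV [v Vv vx] | move=> /AW [v Wv vx]];
    exists v => //; [left | right].
- by exists V.
by exists V; split=> // x [y Yy Ayx]; apply: AV Ayx.
Qed.

Lemma finite_ext_cov_trans a U W :
  finite_ext_cov a U -> (forall u, U u -> finite_ext_cov u W) ->
  finite_ext_cov a W.
Proof.
move=> aU UW b /aU [V [feV bV VU]].
have [|V' [feV' VV' V'W]] := finite_ext_cov_collect (A := @fball_ext X) (U := W) feV.
  by move=> v /VU [u Uu vu]; apply: UW Uu _ vu.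
by exists V'; split=> // x /bV /VV'.
Qed.

(** * Condition (2) defines a cover when the space is locally compact *)

Section LocallyCompact.
Hypotheses (unifX : is_uniform_space X) (lcX : locally_compact X).

(** The centres come from a compact set around [b_*] and may lie outside [b_*], even far from it. *)
Lemma fball_ext_totally_bounded b (d : metric) (e : {posnum rat}) :
  exists2 Y : set X, finitely_enumerable Y &
    fball_ext b `<=` \bigcup_(y in Y) open_ball (sval d) y e.
Proof.
have [K [_ tbK] bK] := lcX (center b) (fb_radius b) (svalP (fb_metric b)).
have [Y [feY _ KY]] := tbK _ e (svalP d).
by exists Y => // x /bK /KY.
Qed.

(* By locatedness, each ball of the covering either is centred at distance less
   than [r_b + e + e] from [b], or misses [b_*] altogether. *)
Lemma fball_ext_finite_cov b (d : metric) (e : {posnum rat}) U :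
  gmetric_le (fb_dist b) (sval d) ->
  (forall y, ucut (fb_dist b (center b) y) (radius b + e%:num + e%:num) ->
    exists2 u, U u & fball_lt (FBall d e y) u) ->
  exists V,
    [/\ finitely_enumerable V, fball_ext b `<=` fballs_ext V & fballs_lt V U].
Proof.
move=> bd smallU; have e_gt0 : 0 < e%:num by [].
have [Y feY bY] := fball_ext_totally_bounded b d e.
(* Only the trace on [b_*] needs covering, so a ball that misses [b_*] is handled by the empty
   family. *)
pose A y := fball_ext b `&` open_ball (sval d) y e.
have [|V [feV AV VU]] := finite_ext_cov_collect (A := A) (U := U) feY.
  move=> y _; have [L cutL] := us_dedekind unifX (svalP (fb_metric b)) (center b) y.
  have lt_q : radius b + e%:num < radius b + e%:num + e%:num by lra.
  case: (dcut_located cutL lt_q) => [Lbe|/smallU [u Uu yu]].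
    exists set0; split; [exact: finitely_enumerable0 | | by move=> ? []].
    move=> x [/fball_extP bx /open_ballP yx].
    (* A common point [x] would, by symmetry and the triangle inequality, bound the distance from
       [b] to [y] by [radius b + e], which is in the lower cut. *)
    case: (@dcut_disjoint _ _ cutL (radius b + e%:num)); split=> //.
    apply: ucut_dist_triangle bx (bd _ _ _ _).
    by case: (us_sym unifX (svalP d) y x) => _; apply.
  exists [set FBall d e y]; split; first exact: finitely_enumerable1.
    by move=> x [_ yx]; exists (FBall d e y).
  by move=> _ ->; exists u.
exists V; split=> // x bx; apply: AV.
by have [y Yy yx] := bY _ bx; exists y.
Qed.

Lemma finite_ext_cov_balls a (d : metric) (e : {posnum rat}) :
  finite_ext_cov a (fballs_of d e).
Proof.
move=> b _; have e_gt0 : 0 < e%:num by [].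
have [s [ds bs]] := metric_ub d (fb_metric b).
apply: (@fball_ext_finite_cov b s (e%:num / 2)%:pos%R) => // y _.
exists (FBall d e y); first by exists y.
by apply/fball_ltP; split=> //=; apply: ucut_dist_refl; lra.
Qed.

(** Small balls centred near [b] lie below [b'], and [b'] is related by [fballs_sqsub] to a family
    below [U] and to one below [W]. Hence these balls belong to the meet of [U] and [W], and
    finitely many of them, shrunk, cover [b_*]. *)
Lemma finite_ext_cov_down a U W :
  finite_ext_cov a U -> finite_ext_cov a W ->
  finite_ext_cov a (down_meet (@fball_le X) U W).
Proof.
move=> aU aW b /fball_lt_enlargeP [e1 /fball_lt_enlargeP [e2]].
set b' := fball_enlarge b e1; set b'' := fball_enlarge b' e2 => lt_b''a.
have lt_b'b'' : fball_lt b' b'' by apply: fball_lt_enlarge.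
have [V [feV b''V /(fballs_sqsub_ext lt_b'b'' feV b''V)]] := aU _ lt_b''a.
move=> [V1 [_ [d1 [r1 b'V1]] V1U]].
have [V' [feV' b''V' /(fballs_sqsub_ext lt_b'b'' feV' b''V')]] := aW _ lt_b''a.
move=> [V2 [_ [d2 [r2 b'V2]] V2W]].
have [d12 [d1_12 d2_12]] := metric_ub d1 d2.
have [d [d12_d bd]] := metric_ub d12 (fb_metric b).
have [r [rr1 rr2]] := posnum_lower_bound r1 r2.
(* The centres to be treated are within [radius b + e] of [b]; a ball of radius [e] there fits into
   [b'] because [2 e <= e1]. *)
have [e [er ee1]] := posnum_lower_bound r (e1%:num / 2)%:pos%R.
have e_gt0 : 0 < e%:num by [].
have below_C d' (r' : {posnum rat}) y : gmetric_le (sval d') (sval d) ->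
    e%:num <= r'%:num -> fball_le (FBall d e y) (FBall d' r' y).
  move=> d'd er'; apply/fball_leP; split=> //= q lt_q.
  by apply: ucut_dist_refl; lra.
(* Halving [e] leaves room for the strict order: the covering balls have radius [e / 2] and lie
   strictly below those of radius [e]. *)
apply: (@fball_ext_finite_cov b d (e%:num / 2)%:pos%R) => //= y by_.
have yb' : fball_le (FBall d e y) b'.
  apply/fball_leP; split=> //= q lt_q.
  by apply: ucut_le by_ _; move: ee1 => /=; lra.
exists (FBall d e y); last first.
  apply/fball_ltP; split; first exact: gmetric_le_refl.
  by apply: ucut_dist_refl => /=; lra.
have [|v1 /V1U [u Uu /fball_ltW v1u] yv1] := b'V1 (FBall d e y).
  exists b', (FBall d1 r1 y); split=> //; first by exists y.
  by apply: below_C; [apply: gmetric_le_trans d1_12 d12_d | lra].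
have [|v2 /V2W [w Ww /fball_ltW v2w] yv2] := b'V2 (FBall d e y).
  exists b', (FBall d2 r2 y); split=> //; first by exists y.
  by apply: below_C; [apply: gmetric_le_trans d2_12 d12_d | lra].
have [_ leT] := fball_le_preorder X.
by exists u, w; split=> //; [apply: leT yv1 v1u | apply: leT yv2 v2w].
Qed.

Lemma finite_ext_cov_is_cover : is_cover (@fball_le X) finite_ext_cov.
Proof.
have [le_refl _] := fball_le_preorder X.
split.
- by move=> U a Ua b ba; apply: finite_ext_cov_lt ba (le_refl a) Ua.
- exact: finite_ext_cov_trans.
- exact: finite_ext_cov_down.
- by move=> a c ac b ba; apply: finite_ext_cov_lt ba ac erefl.
Qed.

Lemma completion_cov_finite_ext a U : completion_cov a U -> finite_ext_cov a U.
Proof.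
apply; first exact: finite_ext_cov_is_cover.
move=> c _ [{}c|{}c d e]; last exact: finite_ext_cov_balls.
(* For (U1), interpolate: the family [[set b]] is strictly below an enlargement of [b] that is still
   strictly below [c]. *)
move=> b /fball_lt_enlargeP [e lt_bec].
have [le_refl _] := fball_le_preorder X.
exact: finite_ext_cov_lt (fball_lt_enlarge b e) (le_refl _) lt_bec.
Qed.

End LocallyCompact.
End FormalBalls.

Theorem proposition4p9 (X : gus) (unifX : is_uniform_space X)
    (lcX : locally_compact X) (a : fball X) (U : set (fball X)) :
  [<-> completion_cov a U;
       forall b, fball_lt b a -> exists V : set (fball X),
         [/\ finitely_enumerable V, fball_ext b `<=` fballs_ext V & fballs_lt V U];
       forall b, fball_lt b a -> exists V : set (fball X),
         [/\ finitely_enumerable V, fballs_sqsub [set b] V & fballs_lt V U];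
       forall b, fball_lt b a -> exists V : set (fball X),
         [/\ finitely_enumerable V, completion_cov b V & fballs_lt V U]].
Proof.
tfae.
- exact: completion_cov_finite_ext.
- move=> aU b /fball_lt_enlargeP [e /aU [V [feV bV VU]]].
  exact: fballs_sqsub_ext (fball_lt_enlarge b e) feV bV VU.
- move=> aU b /aU [V [feV bV VU]]; exists V; split=> //.
  exact: completion_cov_sqsub.
- by move=> aU; apply: completion_cov_lt => b /aU [V [_ bV VU]]; exists V.
Qed.
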